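(* Let $\mathcal{M}$ be a reversible Markov chain on a state space $\Sigma$ with stationary distribution $\pi$ and label function $\omega:\Sigma\to\mathbb{R}$. Let $m\ge 1$ be an integer, let $\mu>0$, $\varepsilon>0$, $\alpha>0$ and $r$ be real numbers, and let $\sigma_0\in\Sigma$ be a fixed state. Let $k_1,\dots,k_m$ be independent random variables, each geometrically distributed with mean $\mu$ on $\{0,1,2,\dots\}$, and consider $m$ independent trajectories $$\mathcal{T}^1=(X^1_0,X^1_1,\dots,X^1_{k_1}),\quad\dots,\quad\mathcal{T}^m=(X^m_0,X^m_1,\dots,X^m_{k_m})$$ of $\mathcal{M}$ from the common starting point $X^1_0=\dots=X^m_0=\sigma_0$ (the steps of the trajectories being independent of the lengths). Let $\rho$ be the number of indices $i\in\{1,\dots,m\}$ such that $\omega(\sigma_0)$ is an $\varepsilon$-outlier among $\omega(X^i_0),\dots,\omega(X^i_{k_i})$. If $\sigma_0$ is not an $(\varepsilon,\alpha)$-outlier with respect to $k$ drawn from the geometric distribution with mean $\mu$, then $$\Pr\left(\rho\ge m\sqrt{\tfrac{\varepsilon}{\alpha}}+r\right)\le \exp\left(-\min\left(\frac{r^2\sqrt{\alpha/\varepsilon}}{3m},\ \frac{r}{3}\right)\right).$$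
   Context: Markov chains are time-homogeneous, discrete-time, on a discrete (finite or countable) state space $\Sigma$, specified by transition probabilities $P(\sigma,\tau)$. A trajectory of $\mathcal{M}$ from $\sigma_0$ is a sequence $X_0=\sigma_0,X_1,X_2,\dots$ of random variables with $\Pr(X_i=\sigma_i\mid X_{i-1}=\sigma_{i-1},\dots,X_0=\sigma_0)=P(\sigma_{i-1},\sigma_i)$. A trajectory is $\pi$-stationary if $X_0\sim\pi$, where $\pi$ is a stationary distribution. $\mathcal{M}$ is reversible (with respect to $\pi$) if every $\pi$-stationary trajectory $X_0,\dots,X_k$ has the same distribution as its reverse $X_k,\dots,X_0$. A real number $a_0$ is an $\varepsilon$-outlier among $a_0,\dots,a_k$ if $\#\{i\in\{0,\dots,k\}: a_i\le a_0\}\le \varepsilon(k+1)$. The geometric distribution with mean $\mu$ on $\{0,1,2,\dots\}$ takes the value $t$ with probability $\frac{1}{\mu+1}\left(1-\frac{1}{\mu+1}\right)^t$. For $\sigma\in\Sigma$, let $p^{\mu}_{0,\varepsilon}(\sigma)$ be the probability that, for $k$ drawn from the geometric distribution with mean $\mu$ and a trajectory $\sigma=X_0,X_1,\dots,X_k$ of $\mathcal{M}$ started at $\sigma$ (with steps independent of $k$), $\omega(\sigma)$ is an $\varepsilon$-outlier among $\omega(X_0),\dots,\omega(X_k)$. The state $\sigma_0$ is an $(\varepsilon,\alpha)$-outlier with respect to $k$ drawn from the geometric distribution with mean $\mu$ if $p^{\mu}_{0,\varepsilon}(\sigma_0)$ is in the largest $\alpha$ fraction of the values $p^{\mu}_{0,\varepsilon}(\sigma)$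 over all states $\sigma\in\Sigma$, weighted according to $\pi$; that is, if $\Pr_{\sigma\sim\pi}\big(p^{\mu}_{0,\varepsilon}(\sigma)\ge p^{\mu}_{0,\varepsilon}(\sigma_0)\big)\le\alpha$. *)

(* Defs.v *)
From mathcomp Require Import all_boot all_order all_algebra.
From mathcomp Require Import all_classical all_reals all_analysis.
Set Implicit Arguments.
Unset Strict Implicit.
Unset Printing Implicit Defensive.
Import Order.TTheory GRing.Theory Num.Theory.
Import numFieldNormedType.Exports.
Local Open Scope classical_set_scope.
Local Open Scope ring_scope.

(** * Random elements of countable sets *)

(* The state space carries its discrete sigma-algebra; since it is countable,
   measurability can be tested on singletons. *)
Definition discrete_rv d (Omega : measurableType d) (T : Type)
    (X : Omega -> T) : Prop :=
  forall t, measurable (X @^-1` [set t]).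

Definition sigma_of (Omega I T : Type) (X : I -> Omega -> T) : set (set Omega) :=
  <<s [set A | exists i t, A = X i @^-1` [set t]] >>.

Definition mutually_independent (R : realType) d (Omega : measurableType d)
    (Pr : probability Omega R) (I : finType) (F : I -> set (set Omega)) : Prop :=
  forall (J : {set I}) (E : I -> set Omega),
    (forall i, i \in J -> F i (E i)) ->
    (Pr (\bigcap_(i in [set` J]) E i) = \prod_(i in J) Pr (E i))%E.

Definition cond_prob (R : realType) d (Omega : measurableType d)
    (Pr : probability Omega R) (A B : set Omega) : R :=
  fine (Pr (A `&` B)) / fine (Pr B).

Definition geometric_pmf (R : realType) (mu : R) (t : nat) : R :=
  (mu + 1)^-1 * (1 - (mu + 1)^-1) ^+ t.

Definition geometrically_distributed (R : realType) d (Omega : measurableType d)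
    (Pr : probability Omega R) (mu : R) (K : Omega -> nat) : Prop :=
  discrete_rv K /\
  forall t, Pr (K @^-1` [set t]) = (geometric_pmf mu t)%:E.

(** * Markov chains *)

Record markov_chain (R : realType) (S : countType) := MarkovChain {
  transition :> S -> S -> R;
  transition_ge0 : forall s t, 0 <= transition s t;
  transition_sum1 :
    forall s, (\esum_(t in [set: S]) (transition s t)%:E = 1)%E }.

Definition history (Omega S : Type) (X : nat -> Omega -> S) (x : nat -> S)
    (k : nat) : set Omega :=
  [set w | forall j, (j <= k)%N -> X j w = x j].

(* Only [X 0], ..., [X k] matter.  The Markov property is required whenever
   the conditional probability makes sense. *)
Definition trajectory_upto (R : realType) (S : countType) (M : markov_chain R S)
    d (Omega : measurableType d) (Pr : probability Omega R)
    (k : nat) (X : nat -> Omega -> S) : Prop :=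
  (forall i, (i <= k)%N -> discrete_rv (X i)) /\
  (forall i (x : nat -> S), (i < k)%N -> Pr (history X x i) != 0%E ->
     cond_prob Pr (X i.+1 @^-1` [set x i.+1]) (history X x i)
     = M (x i) (x i.+1)).

Definition trajectory_from (R : realType) (S : countType) (M : markov_chain R S)
    d (Omega : measurableType d) (Pr : probability Omega R)
    (s0 : S) (X : nat -> Omega -> S) : Prop :=
  (forall k, trajectory_upto M Pr k X) /\
  Pr (X 0%N @^-1` [set s0]) = 1%E.

Definition stationary (R : realType) (S : countType) (M : markov_chain R S)
    (pi : S -> R) : Prop :=
  [/\ forall s, 0 <= pi s,
      (\esum_(s in [set: S]) (pi s)%:E = 1)%E &
      forall t, (\esum_(s in [set: S]) (pi s * M s t)%:E = (pi t)%:E)%E].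

Definition reversible (R : realType) (S : countType) (M : markov_chain R S)
    (pi : S -> R) : Prop :=
  stationary M pi /\
  forall d (Omega : measurableType d) (Pr : probability Omega R)
    (k : nat) (X : nat -> Omega -> S),
    trajectory_upto M Pr k X ->
    (forall s, Pr (X 0%N @^-1` [set s]) = (pi s)%:E) ->
    forall x : nat -> S,
      Pr (history X x k) = Pr (history (fun j => X (k - j)%N) x k).

(** * Outliers *)

Definition is_outlier (R : realType) (eps : R) (k : nat) (a : nat -> R) : bool :=
  (#|[pred i : 'I_k.+1 | a i <= a 0%N]|)%:R <= eps * (k.+1)%:R.

Definition path_prob (R : realType) (S : countType) (M : markov_chain R S)
    (s : S) (k : nat) (p : k.-tuple S) : R :=
  \prod_(j < k) M (nth s (s :: p) j) (nth s (s :: p) j.+1).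

(* The probability that [omega s] is an [eps]-outlier along a trajectory of
   geometric length started at [s], computed from the joint law of the length
   and of the steps; see [outlier_probE] below. *)
Definition outlier_prob (R : realType) (S : countType) (M : markov_chain R S)
    (omega : S -> R) (mu eps : R) (s : S) : \bar R :=
  (\sum_(0 <= k <oo) ((geometric_pmf mu k)%:E *
     \esum_(p in [set p : k.-tuple S |
                   is_outlier eps k (fun j => omega (nth s (s :: p) j))])
       (path_prob M s p)%:E))%E.

Definition outlier_state (R : realType) (S : countType) (M : markov_chain R S)
    (pi omega : S -> R) (mu eps alpha : R) (s0 : S) : Prop :=
  (\esum_(s in [set s | outlier_prob M omega mu eps s0 <=
                        outlier_prob M omega mu eps s]) (pi s)%:E
   <= alpha%:E)%E.

Definition outlier_count (R : realType) (S Omega : Type) (omega : S -> R)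
    (eps : R) (m : nat) (K : 'I_m -> Omega -> nat)
    (X : 'I_m -> nat -> Omega -> S) (w : Omega) : nat :=
  #|[pred i : 'I_m | is_outlier eps (K i w) (fun j => omega (X i j w))]|.

(* The lengths [K i] and the whole trajectories [X i] form a single mutually
   independent family. *)
Definition lengths_and_trajectories (Omega S : Type) (m : nat)
    (K : 'I_m -> Omega -> nat) (X : 'I_m -> nat -> Omega -> S)
    (b : 'I_m + 'I_m) : set (set Omega) :=
  match b with
  | inl i => sigma_of (fun _ : unit => K i)
  | inr i => sigma_of (X i)
  end.

Lemma countable_bigcup_prob (R : realType) d (Omega : measurableType d)
    (Pr : probability Omega R) (T : countType) (A : set T) (F : T -> set Omega) :
  (forall t, measurable (F t)) -> trivIset A F ->
  measurable (\bigcup_(t in A) F t) /\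
  Pr (\bigcup_(t in A) F t) = (\esum_(t in A) Pr (F t))%E.
Proof.
move=> mF tF.
pose G n := if @pickle_inv T n is Some t then
              if t \in A then F t else set0 else set0.
have GE : \bigcup_(t in A) F t = \bigcup_n G n.
  apply/seteqP; split=> w.
    by move=> [t At Ft]; exists (pickle t) => //; rewrite /G pickleK_inv mem_set.
  move=> [n _]; rewrite /G; case: (pickle_inv n) => // t.
  by case: ifPn => // /set_mem At Ft; exists t.
have mG n : measurable (G n).
  by rewrite /G; case: (pickle_inv n) => // t; case: ifP.
have tG : trivIset setT G.
  move=> i j _ _ [w []]; rewrite /G.
  case Ei : (pickle_inv i) => [t|//]; case Ej : (pickle_inv j) => [u|//].
  case: ifPn => // /set_mem At Ft; case: ifPn => // /set_mem Au Fu.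
  have tu : t = u by apply: tF => //; exists w.
  move: (@pickle_invK T i) (@pickle_invK T j); rewrite /ocancel Ei Ej /= => <- <-.
  by rewrite tu.
split; first by rewrite GE; exact: bigcupT_measurable.
rewrite GE measure_bigcup//= nneseries_esum//.
rewrite (_ : [set x | _] = setT); last by apply/seteqP; split=> x //= _; rewrite in_setT.
have -> : (\esum_(t in A) Pr (F t) = \esum_(n in pickle @` A) Pr (G n))%E.
  rewrite esum_image; first last.
  - by move=> ? ? _ _; exact: (pcan_inj pickleK).
  by apply: eq_esum => t At; rewrite /= /G pickleK_inv mem_set.
rewrite [RHS]esum_mkcond; apply: eq_esum => n _.
case: ifPn => // /negP nA; rewrite /G.
case En : (pickle_inv n) => [t|]; last exact: measure0.
case: ifPn => [/set_mem At|_]; last exact: measure0.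
case: nA; rewrite inE; exists t => //.
by move: (@pickle_invK T n); rewrite /ocancel En /= => <-.
Qed.

Lemma historyS (Omega S : Type) (X : nat -> Omega -> S) x k :
  history X x k.+1 = X k.+1 @^-1` [set x k.+1] `&` history X x k.
Proof.
apply/seteqP; split=> w.
  by move=> h; split=> [|j jk]; apply: h => //; exact: leqW.
by move=> [hk h] j; rewrite leq_eqVlt => /predU1P[->//|]; exact: h.
Qed.

Lemma history0 (Omega S : Type) (X : nat -> Omega -> S) x :
  history X x 0 = X 0%N @^-1` [set x 0%N].
Proof.
apply/seteqP; split=> w; first by apply.
by move=> h j; rewrite leqn0 => /eqP ->.
Qed.

Lemma measurable_history (R : realType) (S : countType) (M : markov_chain R S)
    d (Omega : measurableType d) (Pr : probability Omega R)
    (k : nat) (X : nat -> Omega -> S) (x : nat -> S) :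
  trajectory_upto M Pr k X -> measurable (history X x k).
Proof.
move=> [mX _]; elim: k mX => [|k IH] mX; first by rewrite history0; exact: mX.
rewrite historyS; apply: measurableI; first exact: mX.
by apply: IH => i ik; apply: mX; exact: leqW.
Qed.

Lemma prob_history (R : realType) (S : countType) (M : markov_chain R S)
    d (Omega : measurableType d) (Pr : probability Omega R)
    (k : nat) (X : nat -> Omega -> S) (x : nat -> S) :
  trajectory_upto M Pr k X ->
  (Pr (history X x k) =
     Pr (X 0%N @^-1` [set x 0%N]) * (\prod_(j < k) M (x j) (x j.+1))%:E)%E.
Proof.
elim: k => [_|k IH [mX cX]]; first by rewrite history0 big_ord0 mule1.
have tk : trajectory_upto M Pr k X.
  by split=> [i ik|i y ik]; [apply: mX|apply: cX] => //; exact: leqW.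
have mH := measurable_history x tk.
have mXk := mX k.+1 (leqnn _) (x k.+1).
rewrite big_ord_recr /= EFinM muleA -IH// historyS.
have [h0|hN0] := eqVneq (Pr (history X x k)) 0%E.
  rewrite h0 mul0e; apply: (@subset_measure0 _ _ _ Pr _ (history X x k)) => //.
  exact: measurableI.
have := cX k x (ltnSn k) hN0; rewrite /cond_prob => <-.
have f1 := fin_num_measure Pr _ mH.
have f2 := fin_num_measure Pr _ (measurableI _ _ mXk mH).
rewrite -[X in (X * _)%E](fineK f1) -EFinM mulrC divfK ?fineK//.
by rewrite fine_eq0.
Qed.

(* [outlier_prob] is the probability it stands for, in any realization of the
   length and of the trajectory. *)
Lemma outlier_probE (R : realType) (S : countType) (M : markov_chain R S)
    (omega : S -> R) (mu eps : R) (s : S)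
    d (Omega : measurableType d) (Pr : probability Omega R) (m : nat)
    (K : 'I_m -> Omega -> nat) (X : 'I_m -> nat -> Omega -> S) (i : 'I_m) :
  geometrically_distributed Pr mu (K i) -> trajectory_from M Pr s (X i) ->
  mutually_independent Pr (lengths_and_trajectories K X) ->
  Pr [set w | is_outlier eps (K i w) (fun j => omega (X i j w))] =
  outlier_prob M omega mu eps s.
Proof.
move=> [mK gK] [tX X0] indep.
pose out k t := [set p : k.-tuple S |
  is_outlier eps k (fun j => omega (nth t (t :: p) j))].
pose H k t (p : k.-tuple S) := history (X i) (nth t (t :: p)) k.
pose L k := K i @^-1` [set k].
pose E t := [set w | is_outlier eps (K i w) (fun j => omega (X i j w))]
            `&` X i 0%N @^-1` [set t].
have mH k t p : measurable (H k t p) by exact: measurable_history (tX k).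
have mLH k t p : measurable (L k `&` H k t p).
  by apply: measurableI; [exact: mK|exact: mH].
have tH k t : trivIset setT (fun p => L k `&` H k t p).
  move=> p q _ _ [w [[_ hp] [_ hq]]].
  apply: eq_from_tnth => j.
  have := hp j.+1 (ltn_ord j); rewrite (hq j.+1 (ltn_ord j)) /=.
  by rewrite -!tnth_nth.
have PLH k t : measurable (\bigcup_(p in out k t) (L k `&` H k t p)) /\
   Pr (\bigcup_(p in out k t) (L k `&` H k t p)) =
   (\esum_(p in out k t) Pr (L k `&` H k t p))%E.
  by apply: countable_bigcup_prob => //; exact: sub_trivIset (tH k t).
have EE t : E t = \bigcup_k \bigcup_(p in out k t) (L k `&` H k t p).
  have outE k (p : k.-tuple S) w : H k t p w ->
      is_outlier eps k (fun j => omega (nth t (t :: p) j)) =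
      is_outlier eps k (fun j => omega (X i j w)).
    move=> h; rewrite /is_outlier; congr (_%:R <= _); apply: eq_card => j.
    by rewrite !inE h ?h// -ltnS ltn_ord.
  apply/seteqP; split=> w.
    move=> [ow hw]; exists (K i w) => //.
    pose p := [tuple X i j.+1 w | j < K i w].
    have hp : H (K i w) t p w.
      case=> [_|j jk]; [exact: hw|rewrite -[nth _ _ _]/(nth t p j)].
      have -> : nth t p j = tnth p (Ordinal jk) by rewrite (tnth_nth t).
      by rewrite tnth_mktuple.
    by exists p => //; have := outE _ _ _ hp; rewrite /out /= => ->.
  move=> [k _ [p op [lk hp]]]; split; last exact: (hp 0%N).
  by rewrite /= lk -(outE _ _ _ hp).
have mE t : measurable (E t).
  by rewrite EE; apply: bigcupT_measurable => k; exact: (PLH k t).1.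
have mE0 : measurable [set w | is_outlier eps (K i w) (fun j => omega (X i j w))].
  rewrite (_ : [set w | _] = \bigcup_(t in setT) E t); last first.
    apply/seteqP; split=> w; first by move=> ow; exists (X i 0%N w).
    by move=> [t _ []].
  have tE : trivIset setT E by move=> t u _ _ [w [[_ <-] [_ <-]]].
  exact: (countable_bigcup_prob Pr mE tE).1.
have mX0 : measurable (X i 0%N @^-1` [set s]) by apply: (tX 0%N).1.
transitivity (Pr (E s)).
  rewrite (measureDI Pr mE0 mX0).
  rewrite [X in (X + _)%E](_ : _ = 0%E) ?add0e//.
  apply: (@subset_measure0 _ _ _ Pr _ (~` (X i 0%N @^-1` [set s]))).
  - exact: measurableD.
  - exact: measurableC.
  - by move=> w [].
  - by rewrite [LHS](probability_setC Pr mX0) X0 subee.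
rewrite EE measure_bigcup//=; last 2 first.
- by move=> k _; exact: (PLH k s).1.
- by move=> k l _ _ [w [[p _ [Lk _]] [q _ [Ll _]]]]; rewrite -Lk -Ll.
rewrite eseries_mkcond; apply: eq_eseriesr => k _; rewrite in_setT.
pose U := \bigcup_(p in out k s) H k s p.
have sH p : sigma_of (X i) (H k s p).
  rewrite /H; elim: (k) (nth s (s :: p)) => [|n IH] x.
    by rewrite history0; apply: sub_sigma_algebra; exists 0%N, (x 0%N).
  rewrite historyS.
  apply: (@measurableI _ (g_sigma_algebraType _)); last exact: IH.
  by apply: sub_sigma_algebra; exists n.+1, (x n.+1).
have sU : sigma_of (X i) U.
  rewrite /U bigcup_mkcond.
  apply: (@countable_bigcupT_measurable _ (g_sigma_algebraType _)) => [|p].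
    exact: countableP.
  by case: ifPn => _; [exact: sH|exact: measurable0].
have -> : \bigcup_(p in out k s) (L k `&` H k s p) = L k `&` U.
  by rewrite setI_bigcupr.
have -> : Pr (L k `&` U) = (Pr (L k) * Pr U)%E.
  pose D (b : 'I_m + 'I_m) := if b is inl _ then L k else U.
  have := indep [set inl i; inr i]%SET D.
  rewrite big_setU1 ?inE//= big_set1 => <-.
    congr (Pr _); apply/seteqP; split=> w.
      by move=> [l h] b /=; rewrite !inE => /orP[]/eqP->.
    by move=> h; split; [apply: (h (inl i))|apply: (h (inr i))];
      rewrite /= !inE eqxx ?orbT.
  move=> b; rewrite !inE => /orP[]/eqP-> //=.
  by apply: sub_sigma_algebra; exists tt, k.
have tH' : trivIset (out k s) (H k s).
  apply: sub_trivIset (subsetT _) _ => p q _ _ [w [hp hq]].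
  apply: eq_from_tnth => j.
  have := hp j.+1 (ltn_ord j); rewrite (hq j.+1 (ltn_ord j)) /=.
  by rewrite -!tnth_nth.
rewrite (countable_bigcup_prob Pr (mH k s) tH').2 gK; congr (_ * _)%E.
by apply: eq_esum => p _; rewrite /H (prob_history _ (tX k)) /= X0 mul1e.
Qed.

(* Main.v *)
(* Run a walk of geometric length in each direction from a stationary start s.
   By reversibility the concatenation is a single stationary walk y, and its
   probability depends on y only, not on the position of s in it. Hence the
   second moment of p = p_{0,eps} under pi is the expected fraction of positions
   of y that are eps-outliers on both of their sides. Counting entries below the
   largest label among these positions shows that this fraction is at most eps.
   If s0 is not an (eps, alpha)-outlier, Markov's inequality for p^2 then gives
   p(s0) <= sqrt(eps / alpha), and rho, a sum of m independent indicators of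
   probability p(s0), obeys the Chernoff bound. *)
Require Import Defs.
From mathcomp Require Import all_boot all_order all_algebra.
From mathcomp Require Import all_classical all_reals all_analysis.
From mathcomp Require Import zify ring lra.
Set Implicit Arguments.
Unset Strict Implicit.
Unset Printing Implicit Defensive.
Import Order.TTheory GRing.Theory Num.Theory.
Import numFieldNormedType.Exports.
Local Open Scope classical_set_scope.
Local Open Scope ring_scope.

(** * Sums over countable sets and detailed balance *)

(** Scaling finite partial sums gives one inequality; the same inequality for [c^-1] and the scaled
    family gives the converse when [c] is positive. *)
Lemma ge0_esumZl (R : realType) (T : choiceType) (I : set T) (a : T -> \bar R)
    (c : R) : 0 <= c -> (forall i, I i -> (0 <= a i)%E) ->
  (\esum_(i in I) (c%:E * a i) = c%:E * \esum_(i in I) a i)%E.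
Proof.
have leZ (k : R) (b : T -> \bar R) : 0 <= k -> (forall i, I i -> (0 <= b i)%E) ->
    (\esum_(i in I) (k%:E * b i) <= k%:E * \esum_(i in I) b i)%E.
  move=> k0 b0; apply: ge_ereal_sup => _ [X [finX XI]] <-.
  rewrite [leLHS](_ : _ = (k%:E * \sum_(i \in X) b i)%E); last first.
    rewrite !fsbig_finite//= big_seq [in RHS]big_seq ge0_sume_distrr// => i.
    by rewrite in_fset_set// inE => /XI/b0.
  by apply: lee_wpmul2l; rewrite ?lee_fin//; apply: esum_ge; exists X.
rewrite le_eqVlt => /predU1P[<- a0|c0 a0].
  by rewrite mul0e esum1// => i _; rewrite mul0e.
apply/eqP; rewrite eq_le (leZ _ _ (ltW c0) a0)/=.
have ca0 i : I i -> (0 <= c%:E * a i)%E.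
  by move=> Ii; apply: mule_ge0; rewrite ?lee_fin ?(ltW c0)// a0.
have := leZ c^-1 _ _ ca0; rewrite invr_ge0 (ltW c0) => /(_ isT).
rewrite (eq_esum (b := a)) => [|i _]; last first.
  by rewrite muleA -EFinM mulVf ?gt_eqF// mul1e.
have c0' : (0 <= c%:E)%E by rewrite lee_fin ltW.
by move=> /(lee_wpmul2l c0'); rewrite muleA -EFinM divff ?gt_eqF// mul1e.
Qed.

(** Used to group walks by length, and pairs of states by their first component. *)
Lemma esum_fiber (R : realType) (T T' : choiceType) (f : T -> T') (I : set T)
    (a : T -> \bar R) : (forall i, I i -> (0 <= a i)%E) ->
  (\esum_(i in I) a i =
   \esum_(y in [set: T']) \esum_(i in [set i | I i /\ f i = y]) a i)%E.
Proof.
move=> a0; rewrite esum_esum => [|y i _ [/a0//]].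
rewrite (reindex_esum I _ (fun i => (f i, i)))//; split.
- by move=> i Ii.
- by move=> i j _ _ [].
- by move=> [y i] [_ [Ii /= <-]]; exists i.
Qed.

(** The measure is a countable sum of weighted Dirac masses. Its total mass is 1, so normalizing
    changes no value and only supplies the probability structure. *)
Lemma nat_probability (R : realType) (w : nat -> R) :
  (forall n, 0 <= w n) -> (\esum_(n in [set: nat]) (w n)%:E = 1)%E ->
  exists P : probability nat R, forall A, P A = (\esum_(n in A) (w n)%:E)%E.
Proof.
move=> w0 w1.
pose nu : {measure set nat -> \bar R} :=
    mseries (fun n => mscale (NngNum (w0 n)) (\d_ n : measure nat R)) 0.
have nuE A : nu A = (\esum_(n in A) (w n)%:E)%E.
  rewrite /nu /= /mseries esum_mkcond nneseries_esumT => [|n]; last first.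
    exact: measure_ge0.
  apply: eq_esum => n _; rewrite /= /mscale /= diracE.
  by case: ifP => /= _; rewrite ?mule1 ?mule0.
exists (mnormalize nu (\d_ 0%N)) => A.
rewrite /= /mnormalize !nuE w1 /= orbF gt_eqF ?lte01//.
by rewrite nuE invr1 mule1.
Qed.

(* Reversibility is a statement about realized trajectories, so a single step
   started from pi has to be realized: on [nat], coding pairs of states. *)
Lemma detailed_balance (R : realType) (S : countType) (M : markov_chain R S)
    (pi : S -> R) (s t : S) :
  reversible M pi -> pi s * M s t = pi t * M t s.
Proof.
move=> [[pi0 pi1 _] rev].
(* Numbers that code no pair get weight 0, so the default value [s] in [X] below affects no
   probability. *)
pose w n := if @pickle_inv (S * S)%type n is Some x then
  pi x.1 * M x.1 x.2 else 0.
have w0 n : 0 <= w n.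
  by rewrite /w; case: pickle_inv => // x; rewrite mulr_ge0 ?transition_ge0.
have wE (B : set nat) (A : set (S * S)) :
    (forall n x, @pickle_inv (S * S)%type n = Some x -> B n <-> A x) ->
    (\esum_(n in B) (w n)%:E = \esum_(x in A) (pi x.1 * M x.1 x.2)%:E)%E.
  move=> BA; transitivity (\esum_(n in pickle @` A) (w n)%:E)%E.
    rewrite esum_mkcond [RHS]esum_mkcond; apply: eq_esum => n _; rewrite /w.
    case E : pickle_inv => [x|]; last by rewrite !if_same.
    have En : pickle x = n.
      by have := @pickle_invK (S * S)%type n; rewrite /ocancel E.
    congr (if _ then _ else _); apply/idP/idP => /set_mem h; apply/mem_set.
      by exists x => //; apply/(BA n x E).
    by case: h => y Ay yn; apply/(BA n y) => //; rewrite -yn pickleK_inv.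
  rewrite esum_image => [|x y _ _]; last exact: (pcan_inj pickleK).
  by apply: eq_esum => x _; rewrite /w pickleK_inv.
have rowE a : (\esum_(x in [set x | x.1 = a]) (pi x.1 * M x.1 x.2)%:E = (pi a)%:E)%E.
  rewrite (reindex_esum [set: S] _ (pair a)); last first.
    by split=> [|? ? _ _ []//|[? b]/= ->]; last by exists b.
  under eq_esum do rewrite /= EFinM.
  rewrite ge0_esumZl ?transition_sum1 ?mule1// => i _.
  by rewrite lee_fin transition_ge0.
have w1 : (\esum_(n in [set: nat]) (w n)%:E = 1)%E.
  transitivity (\esum_(x in [set: S * S]) (pi x.1 * M x.1 x.2)%:E)%E.
    exact: wE.
  rewrite -pi1; under [RHS]eq_esum do rewrite -rowE.
  rewrite (esum_fiber fst) => [|x _]; last first.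
    by rewrite lee_fin mulr_ge0 ?transition_ge0.
  by apply: eq_esum => a _; congr esum; apply/seteqP; split=> x //= -[].
have [P PE] := nat_probability w0 w1.
pose X j n := if @pickle_inv (S * S)%type n is Some x then
  if j == 0%N then x.1 else x.2 else s.
have X0 a : P (X 0%N @^-1` [set a]) = (pi a)%:E.
  by rewrite PE -rowE; apply: wE => n x; rewrite /X /= => ->.
have X1 a b : P (X 1%N @^-1` [set b] `&` X 0%N @^-1` [set a]) = (pi a * M a b)%:E.
  rewrite PE -[RHS](@esum_set1 _ _ (a, b) (fun x => (pi x.1 * M x.1 x.2)%:E)).
    apply: wE => n [x y]; rewrite /X /= => ->.
    by split=> -[/= -> ->].
  by rewrite lee_fin mulr_ge0 ?transition_ge0.
have tX : trajectory_upto M P 1 X.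
  split=> [//|[|//] x _]; rewrite !history0 => h0.
  rewrite /cond_prob X0 X1 /= mulrAC divff ?mul1r//.
  by move: h0; rewrite X0 eqe.
(* On the path [s], [t] the forward history has mass [pi s * M s t], the reversed one
   [pi t * M t s]. *)
have := rev _ _ P 1%N X tX X0 (fun j => if j is 0 then s else t).
rewrite !historyS !history0 subnn subn0 X1 => /=.
by rewrite setIC X1 => -[].
Qed.

(** * Walks of geometric length *)

(** The product of [path_prob], but on sequences of any length: sums over walks of random length
    then range over the single type [seq S], where walks can be reversed and concatenated. *)
Fixpoint walk_prob (R : realType) (S : countType) (M : markov_chain R S)
    (s : S) (p : seq S) : R :=
  if p is t :: q then M s t * walk_prob M t q else 1.

Lemma walk_prob_ge0 (R : realType) (S : countType) (M : markov_chain R S)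
    (s : S) (p : seq S) : 0 <= walk_prob M s p.
Proof. by elim: p s => //= t q IH s; rewrite mulr_ge0 ?transition_ge0. Qed.

Lemma path_probE (R : realType) (S : countType) (M : markov_chain R S)
    (s : S) (k : nat) (p : k.-tuple S) : path_prob M s p = walk_prob M s p.
Proof.
rewrite /path_prob; case: p => p /= /eqP <-.
have : forall x0 u, \prod_(j < size p)
    M (nth x0 (u :: p) j) (nth x0 (u :: p) j.+1) = walk_prob M u p.
  elim: p => [|t q IH] x0 u; first by rewrite big_ord0.
  by rewrite big_ord_recl /= -(IH x0).
exact.
Qed.

Lemma esum_walk_prob (R : realType) (S : countType) (M : markov_chain R S)
    (s : S) (k : nat) :
  (\esum_(p in [set p : seq S | size p = k]) (walk_prob M s p)%:E = 1)%E.
Proof.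
elim: k s => [|k IH] s.
  rewrite (_ : [set p | _] = [set [::]]) ?esum_set1 ?lee_fin ?ler01//.
  by apply/seteqP; split=> p /= => [/size0nil|->].
rewrite (reindex_esum ([set: S] `*`` fun _ => [set p : seq S | size p = k]) _
  (fun x => x.1 :: x.2)); last first.
  split.
  - by move=> [t q] [_ /= <-].
  - by move=> [t q] [u r] _ _ [-> ->].
  - by move=> [//|t q] [qk]; exists (t, q).
rewrite -(@esum_esum _ _ _ _ _ (fun t q => (M s t * walk_prob M t q)%:E)).
  rewrite -(transition_sum1 M s); apply: eq_esum => t _.
  under eq_esum do rewrite EFinM.
  rewrite ge0_esumZl ?transition_ge0 ?IH ?mule1// => q _.
  by rewrite lee_fin walk_prob_ge0.
by move=> t q _ _; rewrite lee_fin mulr_ge0 ?transition_ge0 ?walk_prob_ge0.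
Qed.

Lemma geometric_pmf_ge0 (R : realType) (mu : R) (k : nat) :
  0 < mu -> 0 <= geometric_pmf mu k.
Proof.
move=> mu0; have mu1 : 1 <= mu + 1 by rewrite lerDr ltW.
rewrite mulr_ge0 ?exprn_ge0 ?subr_ge0 ?invf_le1 ?(lt_le_trans ltr01)//.
by rewrite invr_ge0 (le_trans ler01).
Qed.

Lemma esum_geometric_pmf (R : realType) (mu : R) : 0 < mu ->
  (\esum_(k in [set: nat]) (geometric_pmf mu k)%:E = 1)%E.
Proof.
move=> mu0; rewrite -nneseries_esumT => [|k]; last first.
  by rewrite lee_fin geometric_pmf_ge0.
have q0 : 0 < (mu + 1)^-1 by rewrite invr_gt0 addr_gt0.
have q1 : (mu + 1)^-1 < 1 by rewrite invf_lt1 ?ltrDr ?addr_gt0.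
apply: cvg_lim => //.
rewrite (_ : (fun n => _) = EFin \o series (geometric (mu + 1)^-1 (1 - (mu + 1)^-1))).
  rewrite (_ : 1%E = ((mu + 1)^-1 / (1 - (1 - (mu + 1)^-1)))%:E).
    apply: cvg_EFin; first by near=> n.
    by apply: cvg_geometric_series; rewrite ger0_norm ?subr_ge0 1?ltW// ltrBlDr ltrDl.
  by rewrite subKr divff// gt_eqF.
by apply/funext => n; rewrite /= sumEFin /series.
Unshelve. all: by end_near.
Qed.

Definition geometric_walk_prob (R : realType) (S : countType)
    (M : markov_chain R S) (mu : R) (s : S) (p : seq S) : R :=
  geometric_pmf mu (size p) * walk_prob M s p.

Lemma geometric_walk_prob_ge0 (R : realType) (S : countType)
    (M : markov_chain R S) (mu : R) (s : S) (p : seq S) :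
  0 < mu -> 0 <= geometric_walk_prob M mu s p.
Proof. by move=> mu0; rewrite mulr_ge0 ?geometric_pmf_ge0 ?walk_prob_ge0. Qed.

Lemma esum_geometric_walk_prob (R : realType) (S : countType)
    (M : markov_chain R S) (mu : R) (s : S) : 0 < mu ->
  (\esum_(p in [set: seq S]) (geometric_walk_prob M mu s p)%:E = 1)%E.
Proof.
move=> mu0; rewrite -(esum_geometric_pmf mu0) (esum_fiber size) => [|p _]; last first.
  by rewrite lee_fin geometric_walk_prob_ge0.
apply: eq_esum => k _.
transitivity (\esum_(p in [set p : seq S | size p = k])
    ((geometric_pmf mu k)%:E * (walk_prob M s p)%:E))%E.
  rewrite (_ : [set i | _] = [set p : seq S | size p = k]); last first.
    by apply/seteqP; split=> p //= [].
  by apply: eq_esum => p /= <-; rewrite -EFinM.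
rewrite ge0_esumZl ?geometric_pmf_ge0 ?esum_walk_prob ?mule1// => p _.
by rewrite lee_fin walk_prob_ge0.
Qed.

(** Phrased with [count], which is additive over concatenation and invariant under [rev]. The start
    [s] counts itself. *)
Definition walk_outlier (R : realType) (S : Type) (omega : S -> R) (eps : R)
    (s : S) (p : seq S) : bool :=
  (count (fun t => omega t <= omega s) (s :: p))%:R <= eps * (size p).+1%:R.

Lemma is_outlierE (R : realType) (S : Type) (omega : S -> R) (eps : R)
    (s : S) (p : seq S) :
  is_outlier eps (size p) (fun j => omega (nth s (s :: p) j)) =
  walk_outlier omega eps s p.
Proof.
rewrite /is_outlier /walk_outlier; congr (_%:R <= _).
by rewrite -sum1_card -sum1_count (big_nth s) big_mkord.
Qed.

(** Grouping sequences by size recovers the sum over lengths; sequences of size [k] correspond to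
    [k]-tuples through [val]. *)
Lemma outlier_prob_esum (R : realType) (S : countType) (M : markov_chain R S)
    (omega : S -> R) (mu eps : R) (s : S) : 0 < mu ->
  (outlier_prob M omega mu eps s =
   \esum_(p in [set p | walk_outlier omega eps s p])
     (geometric_walk_prob M mu s p)%:E)%E.
Proof.
move=> mu0; rewrite (esum_fiber size) => [|p _]; last first.
  by rewrite lee_fin geometric_walk_prob_ge0.
rewrite /outlier_prob nneseries_esumT => [|k]; last first.
  rewrite mule_ge0 ?lee_fin ?geometric_pmf_ge0// esum_ge0// => p _.
  by rewrite lee_fin path_probE walk_prob_ge0.
apply: eq_esum => k _; rewrite -ge0_esumZl ?geometric_pmf_ge0//; last first.
  by move=> p _; rewrite lee_fin path_probE walk_prob_ge0.
rewrite [RHS](reindex_esum [set p : k.-tuple S |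
    is_outlier eps k (fun j => omega (nth s (s :: p) j))] _ val).
  by apply: eq_esum => p _; rewrite -EFinM /geometric_walk_prob /= size_tuple path_probE.
split.
- by move=> p /= po; rewrite size_tuple -is_outlierE size_tuple.
- by move=> p q _ _; exact: val_inj.
- move=> p [/= po pk]; exists (tcast pk (in_tuple p)); last by rewrite val_tcast.
  by rewrite /= val_tcast /= -pk is_outlierE.
Qed.

(** * Second moment of the outlier probability *)

(* A reversed first walk, the common start and a second walk concatenate to a
   single stationary walk with a marked position. *)
Lemma esum_marked_seq (R : realType) (S : countType) (x0 : S)
    (a : seq S -> nat -> \bar R) : (forall y j, (0 <= a y j)%E) ->
  (\esum_(x in [set: S * (seq S * seq S)])
      a (rev x.2.1 ++ x.1 :: x.2.2) (size x.2.1) =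
   \esum_(y in [set: seq S]) \sum_(j < size y) a y j)%E.
Proof.
move=> a0.
transitivity (\esum_(y in [set: seq S]) \esum_(j in `I_(size y)) a y j)%E.
  rewrite esum_esum//.
  rewrite (reindex_esum [set: S * (seq S * seq S)] _
    (fun x => (rev x.2.1 ++ x.1 :: x.2.2, size x.2.1)))//.
  split.
  - move=> [s [p q]] _; split=> //=.
    by rewrite size_cat size_rev /= addnS leq_addr.
  - move=> [s [p q]] [s' [p' q']] _ _ /= [] + pp.
    move/eqP; rewrite eqseq_cat ?size_rev// => /andP[/eqP/(inv_inj revK) -> /eqP[-> ->]].
    by [].
  - move=> [y j] [_ /= jy].
    (* The inverse map cuts [y] at the mark; the prefix is reversed because the first walk runs
       backward from there. Since [j < size y], the default [x0] is never read. *)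
    exists (nth x0 y j, (rev (take j y), drop j.+1 y)) => //=.
    by rewrite revK size_rev size_takel ?(ltnW jy)// -drop_nth// cat_take_drop.
apply: eq_esum => y _.
by rewrite esum_fset//= fsbig_ord.
Qed.

Definition marked_outlier (R : realType) (S : Type) (omega : S -> R) (eps : R)
    (x0 : S) (y : seq S) (j : nat) : bool :=
  walk_outlier omega eps (nth x0 y j) (rev (take j y)) &&
  walk_outlier omega eps (nth x0 y j) (drop j.+1 y).

Lemma marked_outlier_cat (R : realType) (S : Type) (omega : S -> R) (eps : R)
    (x0 s : S) (p q : seq S) :
  marked_outlier omega eps x0 (rev p ++ s :: q) (size p) =
  walk_outlier omega eps s p && walk_outlier omega eps s q.
Proof.
rewrite /marked_outlier nth_cat size_rev ltnn subnn /=.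
rewrite take_size_cat ?size_rev// revK drop_cat size_rev ltnNge leqnSn /=.
by rewrite subSnn /= drop0.
Qed.

(* Among the marked positions take one of maximal label: all the others count
   as entries at most its label. The entry itself is counted on both sides, and
   this gains the 1 that turns [eps * (n + 1)] into [eps * n]. *)
Lemma card_marked_outlier (R : realType) (S : Type) (omega : S -> R) (eps : R)
    (x0 : S) (y : seq S) : 0 < eps ->
  (\sum_(j < size y) marked_outlier omega eps x0 y j)%:R <= eps * (size y)%:R.
Proof.
move=> eps0; set N := (\sum_(_ < _) _)%N.
(* For [eps >= 1] the bound by the number of positions suffices; the main argument needs
   [eps < 1]. *)
have [eps1|eps1] := leP 1 eps.
  apply: (@le_trans _ _ (size y)%:R); last by rewrite ler_peMl ?ler0n.
  rewrite ler_nat -[leqRHS]card_ord -sum1_card leq_sum// => j _.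
  exact: leq_b1.
have [j0 gj0|no] := pickP (fun j : 'I_(size y) =>
    marked_outlier omega eps x0 y j); last first.
  rewrite /N big1 ?mulr_ge0 ?ler0n ?(ltW eps0)// => j _.
  by rewrite no.
case: (@arg_maxP _ _ _ j0 (fun j => marked_outlier omega eps x0 y j)
  (fun j => omega (nth x0 y j)) gj0) => j gj maxj.
set s := nth x0 y j in maxj.
set P := (fun t => omega t <= omega s).
have NP : (N <= count P y)%N.
  rewrite -sum1_count (big_nth x0) big_mkord [leqRHS]big_mkcond leq_sum// => i _.
  by case gi : marked_outlier => //; move: (maxj i gi) => /= hi; rewrite /P hi.
have yE : y = take j y ++ s :: drop j.+1 y.
  by rewrite /s -drop_nth// cat_take_drop.
have cE : (count P (s :: rev (take j y)) + count P (s :: drop j.+1 y) = (count P y).+1)%N.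
  have := congr1 (count P) yE; rewrite count_cat /= count_rev.
  have -> : P s by rewrite /P.
  rewrite /=; lia.
have sE : ((size (rev (take j y))).+1 + (size (drop j.+1 y)).+1 = (size y).+1)%N.
  have := congr1 size yE; rewrite size_cat /= size_rev; lia.
move: gj => /andP[]; rewrite /walk_outlier -/s -/P => h1 h2.
have := lerD h1 h2; rewrite -natrD cE -mulrDr -natrD sE -!natr1.
(* With [c = count P y] and [n = size y], the two sides add up to [c + 1 <= eps * (n + 1)], and
   [eps < 1] absorbs the excess [eps - 1]. *)
move: NP; rewrite -(ler_nat R); nra.
Qed.

(** Detailed balance moves the stationary start backward along the first walk, one step at a time.
    The value 0 is for the empty sequence, which a concatenation around [s] never is. *)
Lemma walk_prob_reversal (R : realType) (S : countType) (M : markov_chain R S)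
    (pi : S -> R) (s t : S) (p q : seq S) : reversible M pi ->
  pi s * walk_prob M s p * walk_prob M s q =
  (if rev p ++ s :: q is u :: l then pi u * walk_prob M u l else 0).
Proof.
move=> rev_M; elim: p s q => [|u p IH] s q; first by rewrite /= mulr1.
rewrite rev_cons cat_rcons -IH /= -!mulrA [walk_prob M u p * (M u s * _)]mulrCA.
by rewrite !mulrA (detailed_balance s u rev_M).
Qed.

(** The square becomes a sum over pairs of walks from [s]; finiteness allows one factor to be
    treated as a real constant and moved inside the other sum. *)
Lemma esum_sqr (R : realType) (S : countType) (pi : S -> R) (u : S -> seq S -> R) :
  (forall s, 0 <= pi s) -> (forall s p, 0 <= u s p) ->
  (forall s, \esum_(p in [set: seq S]) (u s p)%:E \is a fin_num) ->
  (\esum_(s in [set: S]) ((pi s)%:E * ((\esum_(p in [set: seq S]) (u s p)%:E) *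
                                    (\esum_(p in [set: seq S]) (u s p)%:E))) =
   \esum_(x in [set: S * (seq S * seq S)])
      (pi x.1 * u x.1 x.2.1 * u x.1 x.2.2)%:E)%E.
Proof.
move=> pi0 u0 fu.
transitivity (\esum_(s in [set: S]) \esum_(x in [set: seq S * seq S])
    (pi s * u s x.1 * u s x.2)%:E)%E; last first.
  rewrite (@esum_esum _ _ _ _ _ (fun s x => (pi s * u s x.1 * u s x.2)%:E)).
    by congr esum; apply/seteqP; split.
  by move=> s x _ _; rewrite lee_fin !mulr_ge0.
apply: eq_esum => s _.
transitivity (\esum_(p in [set: seq S]) \esum_(q in [set: seq S])
    (pi s * u s p * u s q)%:E)%E; last first.
  rewrite (@esum_esum _ _ _ _ _ (fun p q => (pi s * u s p * u s q)%:E)).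
    by congr esum; apply/seteqP; split.
  by move=> p q _ _; rewrite lee_fin !mulr_ge0.
have ue p : (0 <= (u s p)%:E)%E by rewrite lee_fin.
transitivity (\esum_(p in [set: seq S])
    ((pi s * fine (\esum_(q in [set: seq S]) (u s q)%:E))%:E * (u s p)%:E))%E.
  rewrite ge0_esumZl//; last first.
    by rewrite mulr_ge0// fine_ge0// esum_ge0.
  by rewrite EFinM (fineK (fu s)) muleA.
apply: eq_esum => p _.
under [RHS]eq_esum do rewrite EFinM.
by rewrite ge0_esumZl ?mulr_ge0// -[in RHS](fineK (fu s)) -!EFinM mulrAC.
Qed.

Lemma outlier_prob_ge0 (R : realType) (S : countType) (M : markov_chain R S)
    (omega : S -> R) (mu eps : R) (s : S) : 0 < mu ->
  (0 <= outlier_prob M omega mu eps s)%E.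
Proof.
move=> mu0; rewrite outlier_prob_esum// esum_ge0// => p _.
by rewrite lee_fin geometric_walk_prob_ge0.
Qed.

(** The reindexing by marked sequences is used twice: forward, to bound the number of marked
    outliers in each sequence, and backward without the outlier condition, to see that the remaining
    total mass is 1. *)
Lemma outlier_prob_second_moment (R : realType) (S : countType)
    (M : markov_chain R S) (pi omega : S -> R) (mu eps : R) (x0 : S) :
  reversible M pi -> 0 < mu -> 0 < eps ->
  (\esum_(s in [set: S]) ((pi s)%:E * (outlier_prob M omega mu eps s *
                                       outlier_prob M omega mu eps s)) <= eps%:E)%E.
Proof.
move=> rev_M mu0 eps0; have [[pi0 pi1 _] _] := rev_M.
pose v := geometric_walk_prob M mu.
have v0 s p : 0 <= v s p by exact: geometric_walk_prob_ge0.
pose b s p := walk_outlier omega eps s p.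
have bv0 s p : 0 <= (b s p)%:R * v s p by rewrite mulr_ge0 ?ler0n.
pose q := (mu + 1)^-1.
(* The weight of the concatenated walk. Two geometric weights multiply to [q ^+ 2] times a power of
   [1 - q] whose exponent is the total number of steps, so the position of the mark disappears. *)
pose h (y : seq S) := if y is s :: l then
  q ^+ 2 * (1 - q) ^+ size l * (pi s * walk_prob M s l) else 0.
have hE s p l : pi s * v s p * v s l = h (rev p ++ s :: l).
  transitivity (q ^+ 2 * (1 - q) ^+ (size p + size l) *
      (pi s * walk_prob M s p * walk_prob M s l)).
    by rewrite /v /geometric_walk_prob /geometric_pmf -/q exprD; ring.
  rewrite walk_prob_reversal// /h.
  have : size (rev p ++ s :: l) = (size p + size l).+1.
    by rewrite size_cat size_rev addnS.
  by case: (rev p ++ s :: l) => //= u k [<-].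
have h0 y : 0 <= h y.
  case: y => [|s l]; first by rewrite /h.
  rewrite -[s :: l]/(rev [::] ++ s :: l) -hE.
  by apply: mulr_ge0 => //; exact: mulr_ge0.
have vsum s : (\esum_(p in [set: seq S]) (v s p)%:E = 1)%E.
  exact: esum_geometric_walk_prob.
have oE s : outlier_prob M omega mu eps s =
    (\esum_(p in [set: seq S]) ((b s p)%:R * v s p)%:E)%E.
  rewrite outlier_prob_esum// esum_mkcond; apply: eq_esum => p _.
  case: ifPn => [/set_mem /= po|]; first by rewrite /b po mul1r.
  by rewrite notin_setE /= => /negP/negbTE po; rewrite /b po mul0r.
have osum s : (\esum_(p in [set: seq S]) ((b s p)%:R * v s p)%:E <= 1)%E.
  rewrite -(vsum s); apply: le_esum => p _.
  by rewrite lee_fin; case: (b s p); rewrite ?mul1r// mul0r.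
under eq_esum do rewrite oE.
rewrite esum_sqr//; last first.
  move=> s; rewrite ge0_fin_numE ?(le_lt_trans (osum s)) ?ltry//.
  by apply: esum_ge0 => p _; rewrite lee_fin.
pose g y j := marked_outlier omega eps x0 y j.
rewrite (eq_esum (b := fun x => ((g (rev x.2.1 ++ x.1 :: x.2.2) (size x.2.1))%:R *
    h (rev x.2.1 ++ x.1 :: x.2.2))%:E)%E); last first.
  move=> [s [p l]] _ /=; rewrite -hE /g marked_outlier_cat -/(b s p) -/(b s l).
  by congr EFin; case: (b s p); case: (b s l); rewrite /= ?(mul0r, mulr0, mul1r).
rewrite (@esum_marked_seq _ _ x0 (fun y j => ((g y j)%:R * h y)%:E)); last first.
  by move=> y j; rewrite lee_fin mulr_ge0 ?ler0n.
apply: (@le_trans _ _ (\esum_(y in [set: seq S])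
    (eps%:E * \sum_(j < size y) (h y)%:E)))%E.
  apply: le_esum => y _; rewrite !sumEFin -EFinM lee_fin -mulr_suml -natr_sum.
  rewrite sumr_const card_ord -[h y *+ _]mulr_natl mulrA ler_wpM2r//.
  exact: card_marked_outlier.
rewrite ge0_esumZl ?(ltW eps0)//; last first.
  by move=> y _; rewrite sumEFin lee_fin sumr_ge0.
(* Summing [h] over all marks of all sequences gives back two unconstrained walks from a stationary
   start. *)
rewrite -(@esum_marked_seq _ _ x0 (fun y j => (h y)%:E)) => [|y j]; last first.
  by rewrite lee_fin.
rewrite (eq_esum (b := fun x => (pi x.1 * v x.1 x.2.1 * v x.1 x.2.2)%:E)); last first.
  by move=> x _; rewrite hE.
rewrite -esum_sqr//; last by move=> s; rewrite vsum.
under eq_esum do rewrite vsum !mule1.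
by rewrite pi1 mule1.
Qed.

(** Markov's inequality: states whose outlier probability is at least [p0] have [pi]-mass above
    [alpha], and each contributes at least [p0 ^+ 2] times its mass to the second moment. *)
Lemma non_outlier_state_bound (R : realType) (S : countType)
    (M : markov_chain R S) (pi omega : S -> R) (mu eps alpha p0 : R) (s0 : S) :
  reversible M pi -> 0 < mu -> 0 < eps -> 0 < alpha ->
  ~ outlier_state M pi omega mu eps alpha s0 ->
  outlier_prob M omega mu eps s0 = p0%:E -> 0 <= p0 ->
  p0 <= Num.sqrt (eps / alpha).
Proof.
move=> rev_M mu0 eps0 alpha0 /negP; rewrite -ltNge => lt_alpha p0E p0_ge0.
have [[pi0 _ _] _] := rev_M.
suff: p0 ^+ 2 * alpha <= eps.
  move=> h; rewrite -(ger0_norm p0_ge0) -sqrtr_sqr ler_wsqrtr//.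
  by rewrite ler_pdivlMr.
rewrite -lee_fin; apply: le_trans (outlier_prob_second_moment omega s0 rev_M mu0 eps0).
rewrite EFinM.
apply: (@le_trans _ _ ((p0 ^+ 2)%:E *
    \esum_(s in [set s | outlier_prob M omega mu eps s0 <=
                         outlier_prob M omega mu eps s]) (pi s)%:E))%E.
  by apply: lee_wpmul2l; rewrite ?lee_fin ?sqr_ge0// ltW.
rewrite -ge0_esumZl ?sqr_ge0//; last by move=> s _; rewrite lee_fin.
rewrite esum_mkcond; apply: le_esum => s _; rewrite muleC.
case: ifPn => [/set_mem /= le_p|_]; last first.
  by rewrite mule_ge0 ?lee_fin// mule_ge0// outlier_prob_ge0.
apply: lee_wpmul2l; first by rewrite lee_fin.
by rewrite expr2 EFinM -p0E lee_pmul// p0E lee_fin.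
Qed.

(** * Independence and the Chernoff bound *)

(** Independence passes to countable disjoint unions by enlarging the classes one index at a time,
    each time with countable additivity. *)
Lemma mutually_independent_bigcup (R : realType) d (Omega : measurableType d)
    (Pr : probability Omega R) (I : finType) (F G : I -> set (set Omega)) :
  mutually_independent Pr F ->
  (forall i A, F i A -> measurable A) ->
  (forall i A, G i A -> exists D : nat -> set Omega,
     [/\ forall n, F i (D n), trivIset setT D & A = \bigcup_n D n]) ->
  mutually_independent Pr G.
Proof.
move=> indF mF GF.
have mG i A : G i A -> measurable A.
  move=> /GF[D [FD _ ->]]; apply: bigcupT_measurable => n.
  exact: mF (FD n).
(* Mixed statement for the induction: indices in [U] already carry events of [G], the others events
   of [F]. *)
suff H (U J : {set I}) (E : I -> set Omega) :
    (forall i, i \in J -> (if i \in U then G i else F i) (E i)) ->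
    (Pr (\bigcap_(i in [set` J]) E i) = \prod_(i in J) Pr (E i))%E.
  move=> J E GE; apply: (H J) => i iJ; rewrite iJ; exact: GE.
have [n] := ubnP #|U|; elim: n => // n IH in U J E *; rewrite ltnS => Un HE.
have mE i : i \in J -> measurable (E i).
  by move=> /HE; case: ifP => _; [exact: mG|exact: mF].
have [U0|[i iU]] := set_0Vmem U.
  by apply: indF => i /HE; rewrite U0 inE.
have U'n : (#|U :\ i| < n)%N by rewrite (leq_trans _ Un)// [leqRHS](cardsD1 i) iU.
have [iJ|iJ] := boolP (i \in J); last first.
  apply: (IH _ _ _ U'n) => j jJ; have := HE j jJ; rewrite !inE.
  by case: eqVneq jJ iJ => // -> ->.
have [D [FD tD ED]] : exists D : nat -> set Omega,
    [/\ forall n, F i (D n), trivIset setT D & E i = \bigcup_n D n].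
  by apply: GF; have := HE i iJ; rewrite iU.
(* The event at [i] is replaced by its [k]-th piece, which brings [i] back to [F]. *)
pose E' k j := if j == i then D k else E j.
have E'i k : E' k i = D k by rewrite /E' eqxx.
have E'j k j : j != i -> E' k j = E j by rewrite /E' => /negbTE ->.
have E'P k : (Pr (\bigcap_(j in [set` J]) E' k j) =
    Pr (D k) * \prod_(j in J :\ i) Pr (E j))%E.
  rewrite (IH (U :\ i)) => [|//|j jJ].
    rewrite (big_setD1 i)//= E'i; congr (_ * _)%E.
    by apply: eq_bigr => j; rewrite !inE => /andP[ji _]; rewrite E'j.
  rewrite !inE; have [->|ji] := eqVneq j i; first by rewrite E'i.
  by rewrite E'j//; exact: HE.
have capE : \bigcap_(j in [set` J]) E j = \bigcup_k \bigcap_(j in [set` J]) E' k j.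
  apply/seteqP; split=> w.
    move=> h; have : E i w by exact: h.
    rewrite ED => -[k _ Dk]; exists k => // j jJ.
    by have [->|ji] := eqVneq j i; rewrite ?E'i// E'j//; exact: h.
  move=> [k _ h] j jJ; have [->|ji] := eqVneq j i.
    by rewrite ED; exists k => //; rewrite -(E'i k); exact: h.
  by rewrite -(E'j k)//; exact: h.
have mD k : measurable (D k) by exact: mF (FD k).
rewrite capE measure_bigcup//; last 2 first.
- move=> k _; apply: fin_bigcap_measurable => // j jJ.
  by have [->|ji] := eqVneq j i; rewrite ?E'i// E'j//; exact: mE.
- move=> k l _ _ [w [hk hl]]; apply: tD => //; exists w.
  by split; [rewrite -(E'i k)|rewrite -(E'i l)]; [exact: hk|exact: hl].
have finP : (\prod_(j in J :\ i) Pr (E j))%E \is a fin_num.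
  by apply: prode_fin_num => j; rewrite inE => /andP[_ /mE]; exact: fin_num_measure.
rewrite (eq_eseriesr (g := fun k =>
    ((fine (\prod_(j in J :\ i) Pr (E j)))%:E * Pr (D k))%E)); last first.
  by move=> k _; rewrite [LHS]E'P muleC fineK.
rewrite nneseriesZl//.
rewrite fineK// muleC [RHS](big_setD1 i)//=; congr (_ * _)%E.
by rewrite ED measure_bigcup.
Qed.

(** Merges the two classes attached to one index, here a length and its trajectory, into one. *)
Lemma mutually_independent_setI (R : realType) d (Omega : measurableType d)
    (Pr : probability Omega R) (I : finType) (F : I + I -> set (set Omega)) :
  mutually_independent Pr F ->
  mutually_independent Pr
    (fun i => [set A | exists L B, [/\ F (inl i) L, F (inr i) B & A = L `&` B]]).
Proof.
move=> indF J E HE.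
have /choice[f fP] : forall i, exists LB : set Omega * set Omega, i \in J ->
    [/\ F (inl i) LB.1, F (inr i) LB.2 & E i = LB.1 `&` LB.2].
  move=> i; have [iJ|_] := boolP (i \in J); last by exists (set0, set0).
  by have [L [B LB]] := HE i iJ; exists (L, B).
pose D b := match b with inl i => (f i).1 | inr i => (f i).2 end.
have prodE (J' : {set I}) : J' \subset J ->
    (Pr (\bigcap_(i in [set` J']) E i) =
     \prod_(i in J') Pr (f i).1 * \prod_(i in J') Pr (f i).2)%E.
  move=> /fintype.subsetP J'J.
  have := indF [set b : I + I |
    match b with inl i => i \in J' | inr i => i \in J' end]%SET D.
  rewrite big_sumType /=.
  under eq_bigl do rewrite inE; under [X in (_ * X)%E]eq_bigl do rewrite inE.
  move=> <-.
    congr (Pr _); apply/seteqP; split=> w h.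
      by case=> i /=; rewrite inE => iJ'; have [_ _ EE] := fP i (J'J i iJ');
        have := h i iJ'; rewrite EE => -[].
    move=> i iJ'; have [_ _ ->] := fP i (J'J i iJ').
    by split; [apply: (h (inl i))|apply: (h (inr i))]; rewrite /= inE.
  by case=> i; rewrite inE => /J'J/fP[].
rewrite prodE// -big_split /=; apply: eq_bigr => i iJ.
(* The product formula on a singleton gives [Pr (E i)] as the product of its two factors. *)
have := prodE [set i]%SET; rewrite finset.sub1set => /(_ iJ); rewrite !big_set1 => <-.
congr (Pr _); apply/seteqP; split=> w.
  by move=> h; apply: (h i); rewrite /= inE.
by move=> Ew j /=; rewrite inE => /eqP ->.
Qed.

(** * An exponential inequality and the Chernoff bound *)

(** Equivalent to [2 * x / (2 + x) <= ln (1 + x)]. It provides a rational exponent for the Chernoff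
    bound in place of the optimal [ln (1 + x)]. *)
Lemma le_expR_pade (R : realType) (x : R) : 0 <= x ->
  expR (2 * x / (2 + x)) <= 1 + x.
Proof.
move=> x0; have x1 : 0 < 1 + x by rewrite ltr_pwDl.
rewrite -[leRHS]lnK ?posrE// ler_expR ler_pdivrMr ?ltr_pwDl//.
pose f (y : R) := ln (1 + y) * (2 + y) - 2 * y.
have df (y : R) : 0 <= y ->
    is_derive y 1 f ((1 + y)^-1 * (2 + y) + ln (1 + y) - 2).
  move=> y0; have y1 : 0 < 1 + y by rewrite ltr_pwDl.
  have dl : is_derive y 1 (fun z : R => ln (1 + z)) (1 + y)^-1.
    have := @is_derive1_comp _ (@ln R) (cst 1 + id) y _ _ (is_derive1_ln y1)
      (is_deriveD (is_derive_cst _ _ _) (is_derive_id _ _)).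
    by rewrite add0r mulr1.
  have := is_deriveB (is_deriveM dl
      (is_deriveD (is_derive_cst (2 : R) _ _) (is_derive_id y 1)))
    (is_deriveZ 2 (is_derive_id y 1)).
  rewrite (_ : (_ - _)%R = f :> (R -> R))//.
  move=> h; apply: (is_derive_eq h); rewrite /GRing.scale /=.
  by rewrite -[(_ + id) y]/(2 + y); ring.
suff: f 0 <= f x by rewrite /f addr0 ln1 mul0r mulr0 subrr subr_ge0.
apply: (@ger0_derive1_ndecry R f 0) => //.
- by move=> y; rewrite in_itv/= andbT => /ltW/df[].
- move=> y; rewrite in_itv/= andbT => /ltW y0; rewrite derive1E.
  rewrite (@derive_val _ _ _ _ _ _ _ (df _ y0)).
  have y1 : 0 < 1 + y by rewrite ltr_pwDl.
  (* The inequality [ln (1 + z) <= z] at [z = - y / (1 + y)], where [1 + z] is the inverse of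
     [1 + y]; it says that the derivative of [f] is nonnegative. *)
  have : ln (1 + - (y / (1 + y))) <= - (y / (1 + y)).
    by apply: le_ln1Dx; rewrite ltrN2 ltr_pdivrMr// mul1r ltrDr.
  have -> : 1 + - (y / (1 + y)) = (1 + y)^-1 by field; rewrite gt_eqF.
  rewrite lnV ?posrE// => h.
  have -> : (1 + y)^-1 * (2 + y) + ln (1 + y) - 2 = ln (1 + y) - y / (1 + y).
    by field; rewrite gt_eqF.
  by rewrite subr_ge0 -lerN2.
- apply: derivable_within_continuous => y; rewrite in_itv/= andbT => y0.
  by case: (df y y0).
Qed.

Lemma measurable_ge_sum_indic (R : realType) d (Omega : measurableType d)
    (I : finType) (A : I -> set Omega) (a : R) : (forall i, measurable (A i)) ->
  measurable [set w | a <= \sum_i \1_(A i) w].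
Proof.
move=> mA.
have mf : measurable_fun setT (fun w => \sum_i \1_(A i) w : R).
  by apply: measurable_sum => i; exact: measurable_realfun.measurable_indic.
have := mf measurableT `[a, +oo[%classic (measurable_itv _).
rewrite setTI; congr measurable.
by apply/seteqP; split=> w /=; rewrite in_itv/= andbT.
Qed.

(* Expanding [\prod_i (1 + t * 1_(A i))] over subsets turns the independence of
   the [A i] into a bound for the moment generating function. *)
Lemma chernoff_independent (R : realType) d (Omega : measurableType d)
    (Pr : probability Omega R) (m : nat) (A : 'I_m -> set Omega) (p lam r : R) :
  mutually_independent Pr (fun i => [set A i]) ->
  (forall i, measurable (A i)) -> (forall i, Pr (A i) = p%:E) ->
  m%:R * p <= lam -> 0 < lam -> 0 <= r ->
  (Pr [set w | (lam + r <= \sum_(i < m) \1_(A i) w)%R]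
    <= (expR (- (r ^+ 2 / (2 * lam + r))))%:E)%E.
Proof.
move=> indA mA PA mp lam0 r0.
set E := [set w | _].
have mE : measurable E by exact: measurable_ge_sum_indic.
(* [x] is the relative excess over [lam], and [t] is chosen so that [expR t <= 1 + x]. *)
pose x := r / lam.
have x0 : 0 <= x by rewrite divr_ge0// ltW.
pose t := 2 * x / (2 + x).
have t0 : 0 <= t by apply: divr_ge0; lra.
pose c (J : {set 'I_m}) := \bigcap_(i in [set` J]) A i.
have mc (J : {set 'I_m}) : measurable (c J) by exact: fin_bigcap_measurable.
have PcJ J : Pr (c J) = (p ^+ #|J|)%:E.
  rewrite /c indA// (eq_bigr (fun=> p%:E)) => [|i _]; last exact: PA.
  by rewrite prodEFin prodr_const.
have prodE w : \prod_(i < m) (x * \1_(A i) w + 1) =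
    \sum_(J : {set 'I_m}) x ^+ #|J| * \1_(c J) w.
  rewrite bigA_distr; apply: eq_bigr => J _.
  rewrite -big_mkcond /= big_split /= prodr_const; congr (_ * _).
  have [wJ|] := pselect (c J w).
    rewrite indicE mem_set// big1// => i iJ.
    by rewrite indicE mem_set//; exact: wJ.
  move=> wJ; rewrite [RHS]indicE memNset//=.
  have [i iJ nAi] : exists2 i, i \in J & ~ A i w.
    apply/not_exists2P => h; apply: wJ => i iJ.
    by have [//|/contrapT] := h i.
  by rewrite (bigD1 i)//= indicE memNset// mul0r.
(* Pointwise form of the exponential Markov inequality, each factor [expR (t * \1_(A i) w)] being at
   most [1 + x * \1_(A i) w]. *)
have ptw w : (expR (t * (lam + r)) * \1_E w) <=
    \sum_(J : {set 'I_m}) x ^+ #|J| * \1_(c J) w.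
  rewrite -prodE [\1_E w]indicE; case: (boolP (w \in E)) => [/set_mem/= Ew|_]; last first.
    by rewrite mulr0 prodr_ge0// => i _; rewrite addr_ge0// mulr_ge0// indicE.
  rewrite mulr1; apply: (@le_trans _ _ (expR (t * \sum_(i < m) \1_(A i) w))).
    by rewrite ler_expR ler_wpM2l.
  rewrite mulr_sumr expR_sum ler_prod// => i _; rewrite expR_ge0/=.
  rewrite indicE; case: (w \in A i); rewrite ?mulr1 ?mulr0 ?expR0 ?add0r//.
  by rewrite addrC; exact: le_expR_pade.
have int_le : ((expR (t * (lam + r)))%:E * Pr E <= ((1 + x * p) ^+ m)%:E)%E.
  rewrite -[E]setIT -(@integral_indic _ _ _ Pr _ measurableT)//.
  rewrite -ge0_integralZl_EFin ?expR_ge0//; last first.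
    exact/measurable_realfun.measurable_EFinP/measurable_realfun.measurable_indic.
  apply: (@le_trans _ _ (\int[Pr]_(w in setT)
      \sum_(J : {set 'I_m}) ((x ^+ #|J|)%:E * (\1_(c J) w)%:E)))%E.
    apply: ge0_le_integral => //.
    - apply: measurable_funeM.
      exact/measurable_realfun.measurable_EFinP/measurable_realfun.measurable_indic.
    - apply: emeasurable_sum => J; apply: measurable_funeM.
      exact/measurable_realfun.measurable_EFinP/measurable_realfun.measurable_indic.
    - move=> w _; rewrite -EFinM.
      by under eq_bigr do rewrite -EFinM; rewrite sumEFin lee_fin ptw.
  rewrite ge0_integral_sum//; last 2 first.
  - move=> J; apply: measurable_funeM.
    exact/measurable_realfun.measurable_EFinP/measurable_realfun.measurable_indic.
  - by move=> J w _; rewrite -EFinM lee_fin mulr_ge0 ?exprn_ge0.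
  have -> : (1 + x * p) ^+ m = \sum_(J : {set 'I_m}) x ^+ #|J| * p ^+ #|J|.
    rewrite addrC -[in LHS](card_ord m) -prodr_const bigA_distr.
    apply: eq_bigr => J _.
    by rewrite -big_mkcond /= prodr_const exprMn.
  rewrite -sumEFin lee_sum// => J _.
  rewrite ge0_integralZl_EFin ?exprn_ge0//; last first.
    exact/measurable_realfun.measurable_EFinP/measurable_realfun.measurable_indic.
  rewrite integral_indic// setIT.
  by rewrite EFinM lee_wpmul2l ?lee_fin ?exprn_ge0// [leLHS]PcJ.
have xp : (1 + x * p) ^+ m <= expR (x * lam).
  (* The sign of [p] is read off from some [A i], so [m = 0] is treated apart. *)
  have [->|/prednK m0] := posnP m.
    by rewrite expr0 -[leLHS]expR0 ler_expR mulr_ge0// ltW.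
  have p0 : 0 <= p by rewrite -lee_fin -(PA (cast_ord m0 ord0)).
  rewrite (le_trans (_ : _ <= expR (x * p) ^+ m))//.
    have xp0 : 0 <= x * p by exact: mulr_ge0.
    by rewrite lerXn2r ?nnegrE ?expR_ge0 ?expR_ge1Dx ?addr_ge0.
  by rewrite -expRM_natl ler_expR mulrCA ler_wpM2l.
have -> : - (r ^+ 2 / (2 * lam + r)) = x * lam - t * (lam + r).
  by rewrite /t /x; field; rewrite !gt_eqF ?ltr_wpDr ?mulr_gt0.
rewrite expRD expRN EFinM lee_pdivlMr ?expR_gt0//.
by rewrite muleC (le_trans int_le)// lee_fin xp.
Qed.

(** * Independence of the outlier events and the tail bound *)

Lemma sigma_of_measurable d (Omega : measurableType d) (I T : Type)
    (X : I -> Omega -> T) (A : set Omega) :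
  (forall i, discrete_rv (X i)) -> sigma_of X A -> measurable A.
Proof.
move=> mX; move: A; apply: smallest_sub; first exact: sigma_algebra_measurable.
by move=> _ [i [t ->]]; exact: mX.
Qed.

(** At a fixed length the event depends on the first [k.+1] states only, hence is a countable union
    of histories. *)
Lemma sigma_of_is_outlier (R : realType) d (Omega : measurableType d)
    (S : countType) (s0 : S) (X : nat -> Omega -> S) (omega : S -> R) (eps : R) (k : nat) :
  sigma_of X [set w | is_outlier eps k (fun j => omega (X j w))].
Proof.
have sH x n : sigma_of X (history X x n).
  elim: n => [|n IH].
    by rewrite history0; apply: sub_sigma_algebra; exists 0%N, (x 0%N).
  rewrite historyS.
  apply: (@measurableI _ (g_sigma_algebraType _)); last exact: IH.
  by apply: sub_sigma_algebra; exists n.+1, (x n.+1).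
pose Q := [set y : k.+1.-tuple S | is_outlier eps k (fun j => omega (nth s0 y j))].
rewrite (_ : [set w | _] = \bigcup_(y in Q) history X (nth s0 y) k).
  rewrite bigcup_mkcond.
  apply: (@countable_bigcupT_measurable _ (g_sigma_algebraType _)) => [|y].
    exact: countableP.
  by case: ifPn => _; [exact: sH|exact: measurable0].
have QE (y : k.+1.-tuple S) w : history X (nth s0 y) k w ->
    is_outlier eps k (fun j => omega (nth s0 y j)) =
    is_outlier eps k (fun j => omega (X j w)).
  move=> h; rewrite /is_outlier; congr (_%:R <= _); apply: eq_card => j.
  by rewrite !inE !h// -ltnS ltn_ord.
apply/seteqP; split=> w.
  pose y := [tuple X j w | j < k.+1].
  have hy : history X (nth s0 y) k w.
    move=> j jk; rewrite -ltnS in jk.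
    by rewrite -[j]/(val (Ordinal jk)) -tnth_nth tnth_mktuple.
  by move=> ow; exists y => //; rewrite /Q /= (QE _ _ hy).
by move=> [y Qy hy]; rewrite /= -(QE _ _ hy).
Qed.

(** Splitting by the value of [K i] writes each event as a disjoint union of intersections of a
    length event with a trajectory event. *)
Lemma mutually_independent_outliers (R : realType) (S : countType) (s0 : S)
    (omega : S -> R) (eps : R) (m : nat)
    d (Omega : measurableType d) (Pr : probability Omega R)
    (K : 'I_m -> Omega -> nat) (X : 'I_m -> nat -> Omega -> S) :
  (forall i, discrete_rv (K i)) -> (forall i j, discrete_rv (X i j)) ->
  mutually_independent Pr (lengths_and_trajectories K X) ->
  mutually_independent Pr
    (fun i => [set [set w | is_outlier eps (K i w) (fun j => omega (X i j w))]]).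
Proof.
move=> mK mX indKX.
apply: (mutually_independent_bigcup (mutually_independent_setI indKX)).
  move=> i _ [L [B [sL sB ->]]]; apply: measurableI.
    by apply: sigma_of_measurable sL => _; exact: mK.
  exact: sigma_of_measurable sB.
move=> i _ ->; exists (fun k => K i @^-1` [set k] `&`
    [set w | is_outlier eps k (fun j => omega (X i j w))]); split.
- move=> k; do 2 eexists; split; [| |reflexivity].
    by apply: sub_sigma_algebra; exists tt, k.
  exact: sigma_of_is_outlier.
- by move=> k l _ _ [w [[/= <- _] [/= <- _]]].
- apply/seteqP; split=> w /=; first by move=> ow; exists (K i w).
  by move=> [k _ [/= ->]].
Qed.

Theorem theorem2p8 (R : realType) (S : countType) (M : markov_chain R S)
    (pi omega : S -> R) (m : nat) (mu eps alpha r : R) (s0 : S)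
    (d : measure_display) (Omega : measurableType d) (Pr : probability Omega R)
    (K : 'I_m -> Omega -> nat) (X : 'I_m -> nat -> Omega -> S)
    (M_rev : reversible M pi)
    (m_ge1 : (1 <= m)%N) (mu_gt0 : 0 < mu) (eps_gt0 : 0 < eps)
    (alpha_gt0 : 0 < alpha)
    (K_geom : forall i, geometrically_distributed Pr mu (K i))
    (X_traj : forall i, trajectory_from M Pr s0 (X i))
    (KX_indep : mutually_independent Pr (lengths_and_trajectories K X))
    (s0_not_outlier : ~ outlier_state M pi omega mu eps alpha s0) :
  (Pr [set w | (m%:R * Num.sqrt (eps / alpha) + r
                <= (outlier_count omega eps K X w)%:R)%R]
   <= (expR (- Num.min (r ^+ 2 * Num.sqrt (alpha / eps) / (3 * m%:R))
                       (r / 3)))%:E)%E.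
Proof.
pose A i := [set w | is_outlier eps (K i w) (fun j => omega (X i j w))].
have mK i : discrete_rv (K i) by case: (K_geom i).
have mX i j : discrete_rv (X i j).
  by have [tX _] := X_traj i; case: (tX j) => + _; apply.
have indA : mutually_independent Pr (fun i => [set A i]).
  exact: mutually_independent_outliers.
have mA i : measurable (A i).
  rewrite (_ : A i = \bigcup_k (K i @^-1` [set k] `&`
      [set w | is_outlier eps k (fun j => omega (X i j w))])).
    apply: bigcupT_measurable => k; apply: measurableI; first exact: mK.
    by apply: (sigma_of_measurable (mX i)); exact: sigma_of_is_outlier.
  apply/seteqP; split=> w /=; first by move=> ow; exists (K i w).
  by move=> [k _ [/= Kk]]; rewrite /A /= Kk.
pose p := fine (outlier_prob M omega mu eps s0).
have PAE i : Pr (A i) = outlier_prob M omega mu eps s0.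
  exact: outlier_probE (K_geom i) (X_traj i) KX_indep.
(* Since [m >= 1], some trajectory realizes the outlier probability, which is therefore finite and
   nonnegative. *)
have i0 : 'I_m := Ordinal m_ge1.
have pE : outlier_prob M omega mu eps s0 = p%:E.
  by rewrite /p -(PAE i0) fineK// fin_num_measure.
have PA i : Pr (A i) = p%:E by rewrite PAE pE.
have p0 : 0 <= p by rewrite -lee_fin -(PA i0).
have p_le : p <= Num.sqrt (eps / alpha).
  exact: (non_outlier_state_bound M_rev mu_gt0 eps_gt0 alpha_gt0 s0_not_outlier pE).
set lam := m%:R * Num.sqrt (eps / alpha).
have lam0 : 0 < lam by rewrite mulr_gt0 ?ltr0n ?sqrtr_gt0 ?divr_gt0.
have countE w : (outlier_count omega eps K X w)%:R = \sum_(i < m) \1_(A i) w :> R.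
  rewrite /outlier_count -sum1_card natr_sum big_mkcond; apply: eq_bigr => i _.
  rewrite indicE; case: ifPn => iA; first by rewrite mem_set.
  by rewrite memNset//; exact/negP.
rewrite (_ : [set w | _] = [set w | (lam + r <= \sum_(i < m) \1_(A i) w)%R]); last first.
  by apply/seteqP; split=> w /=; rewrite countE.
(* As [Num.sqrt (alpha / eps)] is the inverse of [Num.sqrt (eps / alpha)], the first term of the
   minimum is [r ^+ 2 / (3 * lam)]. *)
have -> : r ^+ 2 * Num.sqrt (alpha / eps) / (3 * m%:R) = r ^+ 2 / (3 * lam).
  rewrite /lam -[eps / alpha]invf_div sqrtrV ?divr_ge0 ?ltW//.
  by field; rewrite !gt_eqF ?sqrtr_gt0 ?divr_gt0 ?ltr0n.
(* For [r <= 0] the minimum is at most [r / 3 <= 0], so the right-hand side is at least 1. *)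
have [r0|r0] := leP r 0.
  apply: (@le_trans _ _ 1%E); first exact/probability_le1/measurable_ge_sum_indic.
  rewrite lee_fin -[leLHS]expR0 ler_expR oppr_ge0 ge_min; apply/orP; right; lra.
have mp : m%:R * p <= lam by rewrite ler_wpM2l.
apply: le_trans (chernoff_independent indA mA PA mp lam0 (ltW r0)) _.
rewrite lee_fin ler_expR lerN2 ge_min.
(* The denominator [2 * lam + r] is at most [3 * lam] if [r <= lam], and at most [3 * r] otherwise;
   each case gives one term of the minimum. *)
have [r_le|r_gt] := leP r lam; apply/orP; [left|right].
  rewrite ler_pM2l ?exprn_gt0// lef_pV2 ?posrE; lra.
rewrite ler_pdivrMr; last lra.
rewrite mulrAC ler_pdivlMr; last lra.
nra.
Qed.
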